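(* Let $\mathbb F$ be an algebraically closed field of characteristic $0$, and $k \geq 2$ an integer. For $A \in M_n(\mathbb F)$ non-zero, consider the polynomial map $\omega : M_n(\mathbb F) \times M_n(\mathbb F) \rightarrow M_n(\mathbb F)$ given by $\omega(x_1, x_2) = x_1^k + A x_2^k$. Then the surjectivity of $\omega$ on $M_n(\mathbb F)$, in terms of the nullity $r_0$ of $A$, is as follows. (1) Let $n=3$. If $r_0=0$ or $r_0=1$, then $\omega$ is surjective for every $k\ge 2$. If $r_0=2$, then $\omega$ is surjective when $k=2$ and is not surjective when $k\geq 3$. Moreover, when the map $\omega$ is not surjective, the image of $\omega$ is precisely the set $$Z=M_3(\mathbb F)\setminus \left\{\begin{pmatrix} \mu & u\\ 0 & M \end{pmatrix}:\; \mu \in \mathbb F,\; u \in \mathbb F^2,\; M \in M_2(\mathbb F)\setminus\{0\},\; M^2 = 0\right\}.$$ (2) Let $n=4$. If $r_0=0$ or $r_0=1$, then $\omega$ is surjective for every $k\ge 2$. If $r_0=2$, then $\omega$ is surjective when $k=2$ and when $k=3$, and is not surjective when $k\ge 4$. If $r_0=3$, then $\omega$ is not surjective for every $k\geq 2$.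
   Context: $M_n(\mathbb F)$ denotes the algebra of $n\times n$ matrices over $\mathbb F$. The nullity of $A$ is $r_0=\dim\ker(A)$, which equals the number of Jordan blocks of $A$ corresponding to the eigenvalue $0$. In the definition of $Z$, the matrices are $3\times 3$ in block form: $u$ is written as a $1\times 2$ row vector and the $0$ in the lower left corner is the $2\times 1$ zero column.
   Formalization: In (1), ''the image is precisely Z'' fails as written (e.g. A = E_22, k = 3); it is stated up to change of basis: the image is P Z P^{-1} for every invertible P such that P^{-1}AP is zero outside its first row, and such a P exists (P = 1 gives Z itself). *)

(* Defs.v *)
From mathcomp Require Import all_boot all_order all_algebra.

Set Implicit Arguments.
Unset Strict Implicit.
Unset Printing Implicit Defensive.

Import GRing.Theory.
Local Open Scope ring_scope.

Definition omega (F : fieldType) (n k : nat) (A x1 x2 : 'M[F]_n.+1) :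
    'M[F]_n.+1 :=
  x1 ^+ k + A * x2 ^+ k.

Definition omega_image (F : fieldType) (n k : nat) (A B : 'M[F]_n.+1) : Prop :=
  exists x1 x2 : 'M[F]_n.+1, omega k A x1 x2 = B.

Definition omega_surjective (F : fieldType) (n k : nat) (A : 'M[F]_n.+1) :
    Prop :=
  forall B : 'M[F]_n.+1, omega_image k A B.

(* The columns of [cokermx A] span {v | A *m v = 0}, the kernel of A acting on
   column vectors ([kermx A] is the kernel of the action on row vectors). *)
Definition nullity (F : fieldType) (n : nat) (A : 'M[F]_n) : nat :=
  \rank (cokermx A).

Definition Z (F : fieldType) (B : 'M[F]_3) : Prop :=
  ~ exists (mu : F) (u : 'rV[F]_2) (M : 'M[F]_2),
      [/\ M != 0, M ^+ 2 = 0 & B = block_mx mu%:M u 0 M :> 'M[F]_(1 + 2)].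

(* The set Z is not stable under conjugation, whereas the image of omega is
   conjugated along with A: the image can only be Z in a suitable basis. The
   basis to use is one whose first vector spans the column space of the rank
   one matrix A, so that only the first row of its matrix is nonzero; the
   Jordan forms diag(a, 0, 0) and J_2(0) + J_1(0) are of this shape. *)
Definition first_row_only (F : fieldType) (n : nat) (A : 'M[F]_n.+1) : Prop :=
  forall i j : 'I_n.+1, i != ord0 -> A i j = 0.

(* Main.v *)
Require Import Defs.
From mathcomp Require Import all_boot all_order all_algebra.

Set Implicit Arguments.
Unset Strict Implicit.
Unset Printing Implicit Defensive.

Import GRing.Theory.
Local Open Scope ring_scope.

(* Conjugate so that the column space U of A, of dimension r, is spanned by the
   first r basis vectors. Every T with column space U is A Y with Y invertible,
   and invertible matrices have k-th roots, so B is in the image as soon as some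
   k-th power X has the same last n - r rows as B and B - X has rank r. When
   n - r <= 2, such an X, with an invertible and a zero diagonal block, exists
   unless n - r = 2, B maps U into U, and B induces on the quotient by U a
   nonzero N with N ^ 2 = 0. If r <= 2 <= k <= r + 1, that shape is handled by
   the k-th power of a Jordan block of size k + 1 that passes through U. For the
   converse, v Y ^ m = 0 implies v Y ^ n = 0 for n x n matrices, so if a k-th
   power maps U into U and induces a nilpotent N on the quotient, then
   N ^ i = 0 whenever n <= k i. *)

(** * Roots of invertible matrices, and a bound on nilpotency *)

Lemma closed_field_root (F : closedFieldType) (k : nat) (a : F) :
  (0 < k)%N -> exists b, b ^+ k = a.
Proof.
move=> k_gt0; have /closed_rootP[b] : size ('X^k - a%:P) != 1.
  by rewrite size_XnsubC // eqSS -lt0n.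
by rewrite /root !hornerE subr_eq0 => /eqP; exists b.
Qed.

(* Hensel lifting one linear factor at a time. The factor ['X - a] may already
   divide the modulus [p]; the correction [c *: p] then acts through the
   derivative [k * q(a) ^ (k - 1)], which does not vanish. *)
Lemma poly_kth_root_X (F : closedFieldType) (charF0 : [pchar F] =i pred0)
    (k : nat) (s : seq F) : (0 < k)%N -> 0 \notin s ->
  exists q : {poly F}, \prod_(z <- s) ('X - z%:P) %| q ^+ k - 'X.
Proof.
move=> k_gt0; elim: s => [|a s IHs].
  by exists 0; rewrite big_nil dvd1p.
rewrite inE negb_or eq_sym big_cons => /andP[a_nz /IHs[q]].
set p := \prod_(_ <- _) _ => /dvdpP[t Dq].
(* [h c] is the cofactor of [p] in [(q + c *: p) ^+ k - 'X], so it suffices to choose [c] making it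
   vanish at [a]. *)
pose h c := t + c *: \sum_(i < k) (q + c *: p) ^+ (k.-1 - i) * q ^+ i.
have Dh c : (q + c *: p) ^+ k - 'X = h c * p.
  rewrite -(subrKA (q ^+ k)) Dq subrXX addrAC addrN add0r.
  by rewrite mulrDl -!scalerAl [p * _]mulrC addrC.
suff [c hc0] : exists c, root (h c) a.
  by exists (q + c *: p); rewrite Dh dvdp_mul // dvdp_XsubCl.
have [pa0|pa_nz] := eqVneq p.[a] 0.
  have qa : q.[a] ^+ k = a.
    apply/eqP; rewrite -subr_eq0.
    have := congr1 (horner^~ a) Dq; rewrite /= !hornerE pa0 mulr0 => ->.
    by rewrite eqxx.
  have d_nz : q.[a] ^+ k.-1 *+ k != 0.
    rewrite -mulr_natr mulf_neq0 //.
      apply: contraNneq a_nz => /eqP; rewrite expf_eq0 => /andP[_ /eqP qa0].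
      by rewrite -qa qa0 expr0n eqn0Ngt k_gt0.
    by have /pcharf0P -> := charF0; rewrite -lt0n.
  (* Since [p] vanishes at [a], the value of [h c] there is affine in [c], with slope [k] times
     [q.[a] ^+ k.-1]; this is its root. *)
  exists (- t.[a] / (q.[a] ^+ k.-1 *+ k)).
  rewrite /root !hornerE horner_sum (eq_bigr (fun=> q.[a] ^+ k.-1)) => [|i _].
    by rewrite sumr_const card_ord divfK // addrN.
  by rewrite !hornerE pa0 mulr0 addr0 -exprD subnK // -ltnS prednK.
(* When [p.[a]] is nonzero, [c] can give [q + c *: p] any value at [a], in particular a k-th root
   [b] of [a]. *)
have [b Db] := closed_field_root a k_gt0; exists ((b - q.[a]) / p.[a]).
set c := _ / _; have : ((q + c *: p) ^+ k - 'X).[a] = 0.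
  by rewrite !hornerE divfK // [q.[a] + _]addrC subrK Db addrN.
by rewrite Dh hornerM => /eqP; rewrite mulf_eq0 (negPf pa_nz) orbF.
Qed.

(** Both ['X^m] and the characteristic polynomial, evaluated at [Y], annihilate [v], hence so does
    their gcd. That gcd is a power of ['X] up to a scalar, of degree at most [n]. *)
Lemma mulmx_exp_dim_eq0 (F : fieldType) (n m : nat) (Y : 'M[F]_n)
    (v : 'rV_n) : v *m Y ^+ m = 0 -> v *m Y ^+ n = 0.
Proof.
case: n Y v => [|n] Y v vYm0; first by rewrite [v]thinmx0 mul0mx.
 have [[u w] /= g_eq] := Bezoutp ('X^m) (char_poly Y).
set g := gcdp _ _ in g_eq.
have kill p : g %| p -> v *m horner_mx Y p = 0.
  rewrite -(eqp_dvdl _ g_eq) => /dvdpP[h ->].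
  rewrite mulrC mulrDl rmorphD !rmorphM /= Cayley_Hamilton mulr0 mul0r addr0.
  rewrite rmorphXn /= horner_mx_X.
  have -> : horner_mx Y u * Y ^+ m = Y ^+ m * horner_mx Y u.
    by apply: commrX; apply/commr_sym; apply: comm_mx_horner.
  by rewrite -mulrA -[X in v *m X]/(Y ^+ m *m _) mulmxA vYm0 mul0mx.
suff /kill : g %| 'X^(n.+1) by rewrite rmorphXn /= horner_mx_X.
have : g %| ('X - 0%:P) ^+ m by rewrite subr0 dvdp_gcdl.
case/dvdp_exp_XsubCP => j _ gj; rewrite (eqp_dvdl _ gj) subr0 dvdp_exp2l //.
rewrite -ltnS -(size_polyXn F j) -['X]subr0 -(eqp_size gj).
rewrite -(size_char_poly Y) dvdp_leq ?dvdp_gcdr // monic_neq0 //.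
exact: char_poly_monic.
Qed.

(** Zero is not an eigenvalue, so ['X] has a k-th root modulo the characteristic polynomial; by
    Cayley-Hamilton its value at [X] is a k-th root of [X]. *)
Lemma unitmx_kth_root (F : closedFieldType) (charF0 : [pchar F] =i pred0)
    (k n : nat) (X : 'M[F]_n) : (0 < k)%N -> X \in unitmx ->
  exists2 Y : 'M[F]_n, Y \in unitmx & Y ^+ k = X.
Proof.
case: n X => [|n] X k_gt0 uX.
  by exists X => //; apply/matrixP => - [].
have [s Ds] := closed_field_poly_normal (char_poly X).
rewrite (monicP (char_poly_monic X)) scale1r in Ds.
have s_nz : 0 \notin s.
  rewrite -root_prod_XsubC -Ds -eigenvalue_root_char.
  apply/eigenvalueP => - [v]; rewrite scale0r => vX0.
  by rewrite -[v](mulmxK uX) vX0 mul0mx eqxx.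
have [q /dvdpP[t Dt]] := poly_kth_root_X charF0 k_gt0 s_nz.
have YX : horner_mx X q ^+ k = X.
  have := congr1 (horner_mx X) Dt.
  rewrite -Ds rmorphM rmorphB rmorphXn /= Cayley_Hamilton mulr0 horner_mx_X.
  by move/eqP; rewrite subr_eq0 => /eqP.
exists (horner_mx X q) => //; rewrite -[_ \in _]/(_ \is a GRing.unit).
by rewrite -(unitrX_pos _ k_gt0) YX.
Qed.

(** * Conjugation, and column spaces spanned by the first basis vectors *)

(** The column space lies in the span of the first [r] basis vectors. The entrywise form avoids
    splitting the dimension as a sum. *)
Definition zero_below (F : fieldType) (r m n : nat) (A : 'M[F]_(m, n)) : Prop :=
  forall (i : 'I_m) (j : 'I_n), (r <= i)%N -> A i j = 0.

Lemma zero_below_mulmx (F : fieldType) (r m n p : nat) (A : 'M[F]_(m, n))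
    (B : 'M_(n, p)) : zero_below r A -> zero_below r (A *m B).
Proof.
by move=> A0 i j le_ri; rewrite mxE big1 // => l _; rewrite A0 ?mul0r.
Qed.

Lemma zero_below_dsubmx (F : fieldType) (r s n : nat) (A : 'M[F]_(r + s, n)) :
  zero_below r A <-> dsubmx A = 0.
Proof.
split=> [A0 | A0 i j].
  by apply/matrixP=> i j; rewrite !mxE A0 //= leq_addr.
case: (split_ordP i) => l -> /=; first by rewrite leqNgt ltn_ord.
by move=> _; have := congr1 (fun M : 'M__ => M l j) A0; rewrite !mxE.
Qed.

Lemma conj_exp (F : fieldType) (n k : nat) (P X : 'M[F]_n) : P \in unitmx ->
  invmx P *m X ^+ k *m P = (invmx P *m X *m P) ^+ k.
Proof.
move=> uP; elim: k => [|k IHk]; first by rewrite !expr0 mulmx1 mulVmx.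
by rewrite !exprS -IHk -!mulmxE !mulmxA mulmxK.
Qed.

Lemma omega_image_conj (F : fieldType) (n k : nat) (A B P : 'M[F]_n.+1) :
  P \in unitmx ->
  omega_image k A B <->
  omega_image k (invmx P *m A *m P) (invmx P *m B *m P).
Proof.
have imp (A' B' Q : 'M[F]_n.+1) : Q \in unitmx -> omega_image k A' B' ->
    omega_image k (invmx Q *m A' *m Q) (invmx Q *m B' *m Q).
  move=> uQ [x [y <-]]; exists (invmx Q *m x *m Q), (invmx Q *m y *m Q).
  rewrite /omega -!conj_exp // mulmxDr mulmxDl; congr (_ + _).
  by rewrite -!mulmxE !mulmxA mulmxK.
move=> uP; split=> [|/(imp _ _ (invmx P))]; first exact: imp.
by rewrite unitmx_inv uP invmxK !mulmxA !mulmxV // !mul1mx !mulmxK //; apply.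
Qed.

(** Rank [r] forces both column spaces to be the whole span of the first [r] basis vectors, and
    matrices with equal column spaces differ by an invertible right factor. *)
Lemma zero_below_unit_mul (F : fieldType) (r n : nat) (A T : 'M[F]_n) :
  zero_below r A -> zero_below r T -> \rank A = r -> \rank T = r ->
  exists2 Y : 'M_n, Y \in unitmx & A *m Y = T.
Proof.
have span (M : 'M[F]_n) : zero_below r M -> \rank M = r ->
    (M^T == (pid_mx r : 'M_n))%MS.
  move=> M0 rM.
  have le_rn : (r <= n)%N by rewrite -rM rank_leq_row.
  have sub : (M^T <= (pid_mx r : 'M_n))%MS.
    have {1}-> : M = pid_mx r *m M.
      apply/matrixP=> i j; rewrite mxE (bigD1 i) //= big1 => [|l ne_li].
        rewrite mxE eqxx addr0.
        by case: ltnP => [_|/M0->]; rewrite ?mul1r ?mulr0.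
      by rewrite mxE eq_sym (inj_eq val_inj) (negPf ne_li) mul0r.
    by rewrite trmx_mul tr_pid_mx submxMl.
  by rewrite -(mxrank_leqif_eq sub) mxrank_tr rM rank_pid_mx.
move=> A0 T0 rA rT.
have /eqmxP eA := span _ A0 rA; have /eqmxP eT := span _ T0 rT.
have /eqmxMunitP[Q uQ TQ] : (T^T == A^T)%MS by rewrite !eA !eT !submx_refl.
exists Q^T; first by rewrite unitmx_tr.
by apply: trmx_inj; rewrite trmx_mul trmxK TQ.
Qed.

Lemma omega_image_sub (F : closedFieldType) (charF0 : [pchar F] =i pred0)
    (n k r : nat) (A X T : 'M[F]_n.+1) : (0 < k)%N ->
  zero_below r A -> zero_below r T -> \rank A = r -> \rank T = r ->
  omega_image k A (X ^+ k + T).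
Proof.
move=> k_gt0 A0 T0 rA rT.
have [Y uY <-] := zero_below_unit_mul A0 T0 rA rT.
have [y _ <-] := unitmx_kth_root charF0 k_gt0 uY.
by exists X, y.
Qed.

(** * Writing a matrix as a k-th power plus a matrix of rank [r] *)

Lemma unitmx_pencil (F : closedFieldType) (n : nat) (M N : 'M[F]_n) :
  N \in unitmx -> exists2 t, t != 0 & M - t *: N \in unitmx.
Proof.
(* A root [t] of [p - 1] is neither zero nor an eigenvalue of [M *m invmx N], since [p] vanishes at
   all of these. *)
move=> uN; pose p := 'X * char_poly (M *m invmx N).
have mon_p : p \is monic by rewrite rpredM ?monicX ?char_poly_monic.
have sp : (1 < size p)%N.
  by rewrite /p mulrC size_mulX ?monic_neq0 ?char_poly_monic // size_char_poly.
have /closed_rootP[t] : size (p - 1) != 1.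
  by rewrite size_polyDl ?size_polyN ?size_poly1 // neq_ltn sp orbT.
rewrite /root !hornerE subr_eq0 => /eqP pt1.
have t_nz : t != 0.
  by apply: contra_eq_neq pt1 => ->; rewrite mul0r eq_sym oner_eq0.
exists t => //; have : ~~ root (char_poly (M *m invmx N)) t.
  by apply: contra_eqN pt1 => /rootP->; rewrite mulr0 eq_sym oner_eq0.
rewrite -eigenvalue_root_char /eigenvalue /eigenspace negbK kermx_eq0.
rewrite row_free_unit => uMN.
have -> : M - t *: N = (M *m invmx N - t%:M) *m N.
  by rewrite mulmxBl mulmxKV // mul_scalar_mx.
by rewrite unitmx_mul uMN.
Qed.

Lemma row_free_complete (F : fieldType) (r m : nat) (W : 'M[F]_(m, r + m)) :
  row_free W -> exists T : 'M_(r, r + m), col_mx T W \in unitmx.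
Proof.
move=> fW; have e : \rank (W^C)%MS = r by rewrite mxrank_compl (eqP fW) addnK.
exists (castmx (e, erefl) (row_base (W^C)%MS)).
rewrite -row_full_unit -(eq_row_full (addsmxE _ _)).
rewrite (eq_row_full (adds_eqmx (eqmx_cast _ _) (eqmx_refl W))).
rewrite (eq_row_full (adds_eqmx (eq_row_base _) (eqmx_refl W))).
by rewrite addsmxC addsmx_compl_full.
Qed.

(** Powers of [block_mx Y z 0 0] are [block_mx (Y ^+ i) (Y ^+ i.-1 *m z) 0 0] for positive [i], so
    [z] is found by dividing [x] by a power of the invertible [Y]. *)
Lemma block_kth_root (F : closedFieldType) (charF0 : [pchar F] =i pred0)
    (k m s : nat) (X : 'M[F]_m) (x : 'M_(m, s)) : (0 < k)%N -> X \in unitmx ->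
  exists Y : 'M_(m + s), Y ^+ k = block_mx X x 0 0.
Proof.
case: k => // k k_gt0 uX.
have [Y uY <-] := unitmx_kth_root charF0 k_gt0 uX.
have uYk : Y ^+ k \in unitmx.
  elim: (k) => [|i IHi]; first by rewrite expr0 unitmx1.
  by rewrite exprS -mulmxE unitmx_mul uY.
exists (block_mx Y (invmx (Y ^+ k) *m x) 0 0).
rewrite -[x in RHS](mulKVmx uYk); move: (_ *m x) => y.
elim: (k) => [|i IHi]; first by rewrite !expr1 expr0 mul1mx.
rewrite exprS IHi -mulmxE mulmx_block !mul0mx !mulmx0 !addr0.
by rewrite mulmxA !mulmxE -!exprS.
Qed.

(* The X below is block upper triangular with blocks (X3, 0): its invertible
   block X3 is forced to agree with B on rows [r, r + m), and moving its first
   [r] rows far away along a complement makes both X3 invertible and B - X of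
   full rank r. *)
Lemma kth_power_plus_rank (F : closedFieldType) (charF0 : [pchar F] =i pred0)
    (n k r m : nat) (B : 'M[F]_n) : (0 < k)%N -> (r + m <= n)%N ->
  zero_below (r + m) B ->
  (forall v : 'rV_n, (forall j : 'I_n, ~~ (r <= j < r + m)%N -> v 0 j = 0) ->
     (forall j : 'I_n, (j < r + m)%N -> (v *m B) 0 j = 0) -> v = 0) ->
  exists X T : 'M_n, [/\ B = X ^+ k + T, zero_below r T & \rank T = r].
Proof.
move=> k_gt0 /subnKC; move: (n - (r + m))%N => s def_n.
case: n / def_n B => B /zero_below_dsubmx B0 freeB.
pose B1 := ulsubmx B; pose W := dsubmx B1.
have DB : B = block_mx B1 (ursubmx B) 0 0.
  by rewrite -[LHS]submxK /dlsubmx /drsubmx B0 linear0 linear0.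
have /row_free_complete[T uTW] : row_free W.
  apply: inj_row_free => v vW0.
  have : row_mx (row_mx (0 : 'rV_r) v) (0 : 'rV_s) = 0.
    apply: freeB => j.
      case: (split_ordP j) => l -> /=; last by rewrite row_mxEr mxE.
      rewrite row_mxEl.
      case: (split_ordP l) => l' -> /=; first by rewrite row_mxEl mxE.
      by rewrite leq_addr.
    case: (split_ordP j) => l -> /=; last by [].
    move=> _; rewrite DB mul_row_block !mul0mx !addr0 row_mxEl.
    by rewrite -[B1]vsubmxK mul_row_col mul0mx add0r -/W vW0 mxE.
  by move=> /eqP; rewrite !row_mx_eq0 => /andP[/andP[_ /eqP]].
(* With zero lower rows in [M], the pencil has lower rows [- t *: W]; rescaling them by [- t^-1]
   turns it into [X3]. *)
pose M := col_mx (usubmx B1) 0 : 'M[F]_(r + m).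
have [t t_nz uMt] := unitmx_pencil M uTW.
pose X3 := col_mx (usubmx B1 - t *: T) W.
have uX3 : X3 \in unitmx.
  have -> : X3 = block_mx 1%:M 0 0 (- t^-1)%:M *m (M - t *: col_mx T W).
    rewrite scale_col_mx opp_col_mx add_col_mx add0r mul_block_col.
    rewrite !mul0mx mul1mx addr0 add0r mul_scalar_mx scalerN scaleNr opprK.
    by rewrite scalerA mulVf // scale1r.
  rewrite unitmx_mul uMt andbT block_diag_mx_unit unitmx1 /=.
  by rewrite -scalemx1 unitmxZ ?unitmx1 // unitfE oppr_eq0 invr_eq0.
have [X DX] := block_kth_root charF0 (ursubmx B) k_gt0 uX3.
exists X, (block_mx (col_mx (t *: T) 0) 0 0 0); split.
- rewrite DX add_block_mx !addr0 add_col_mx subrK addr0.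
  by rewrite -[usubmx B1 in RHS]/(usubmx B1) vsubmxK.
- move=> i j; case: (split_ordP i) => l -> /=.
    case: (split_ordP l) => l' -> /=; first by rewrite leqNgt ltn_ord.
    move=> _; case: (split_ordP j) => j' ->.
      by rewrite block_mxEul col_mxEd mxE.
    by rewrite block_mxEur mxE.
  move=> _; case: (split_ordP j) => j' ->.
    by rewrite block_mxEdl mxE.
  by rewrite block_mxEdr mxE.
rewrite rank_diag_block_mx mxrank0 addn0 rank_col_mx0 mxrank_scale_nz //.
apply/eqP; apply: inj_row_free => v vT0.
have : row_mx v (0 : 'rV_m) = 0.
  by rewrite -[LHS](mulmxK uTW) mul_row_col vT0 mul0mx addr0 mul0mx.
by move/eqP; rewrite row_mx_eq0 => /andP[/eqP].
Qed.

(** * Surjectivity when the nullity is at most one *)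

Lemma mxrank_conj (F : fieldType) (n : nat) (A P : 'M[F]_n) : P \in unitmx ->
  \rank (invmx P *m A *m P) = \rank A.
Proof.
move=> uP; rewrite mxrankMfree ?row_free_unit // eqmxMfull //.
by rewrite row_full_unit unitmx_inv.
Qed.

Lemma omega_surjective_conj (F : fieldType) (n k : nat) (A P : 'M[F]_n.+1) :
  P \in unitmx ->
  omega_surjective k (invmx P *m A *m P) <-> omega_surjective k A.
Proof.
move=> uP; split=> surj B; first by apply/(omega_image_conj k A B uP).
have -> : B = invmx P *m (P *m B *m invmx P) *m P.
  by rewrite !mulmxA mulVmx // mul1mx mulmxKV.
exact/(omega_image_conj k A _ uP).
Qed.

Lemma zero_below_conj (F : fieldType) (n : nat) (A : 'M[F]_n) :
  exists2 P, P \in unitmx & zero_below (\rank A) (invmx P *m A *m P).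
Proof.
exists (col_ebase A); first exact: col_ebase_unit.
have -> : invmx (col_ebase A) *m A = pid_mx (\rank A) *m row_ebase A.
  by apply/(canLR (mulKmx (col_ebase_unit A))); rewrite mulmxA mulmx_ebase.
rewrite -mulmxA; apply: zero_below_mulmx => i j le_ri.
by rewrite mxE [(i < _)%N]ltnNge le_ri andbF.
Qed.

(** At most one row of [B] lies beyond the rank of [A]. The splitting applies with [m = 0] if the
    rows there vanish, and with [m = 1] if that row is nonzero. *)
Lemma omega_surjective_corank_le1 (F : closedFieldType)
    (charF0 : [pchar F] =i pred0) (n k : nat) (A : 'M[F]_n.+1) : (0 < k)%N ->
  (n <= \rank A)%N -> omega_surjective k A.
Proof.
move=> k_gt0 rA; have [P uP A0] := zero_below_conj A.
apply/(omega_surjective_conj k A uP) => B.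
suff [m [le_m B0 freeB]] : exists m, [/\ (\rank A + m <= n.+1)%N,
    zero_below (\rank A + m) B &
    forall v : 'rV_n.+1,
      (forall j : 'I_n.+1, ~~ (\rank A <= j < \rank A + m)%N -> v 0 j = 0) ->
      (forall j : 'I_n.+1, (j < \rank A + m)%N -> (v *m B) 0 j = 0) -> v = 0].
  have [X [T [-> T0 rT]]] := kth_power_plus_rank charF0 k_gt0 le_m B0 freeB.
  by apply: (omega_image_sub charF0 X k_gt0 A0 T0); rewrite ?mxrank_conj.
have no_support (v : 'rV[F]_n.+1) : (forall j : 'I_n.+1,
    ~~ (\rank A <= j < \rank A + 0)%N -> v 0 j = 0) -> v = 0.
  move=> v0; apply/rowP => j; rewrite v0 ?mxE // addn0.
  by case: leqP => //=; rewrite ltnNge => ->.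
have [BA0 | ] := boolP
  [forall i : 'I_n.+1, forall j, (\rank A <= i)%N ==> (B i j == 0)].
  exists 0%N; split=> [||v /no_support //]; first by rewrite addn0 rank_leq_row.
  move=> i j; rewrite addn0 => le_i; apply/eqP.
  by move/forallP: BA0 => /(_ i)/forallP/(_ j)/implyP; apply.
case/forallPn=> i /forallPn[j]; rewrite negb_imply => /andP[le_i Bij].
have rAn : \rank A = n.
  by apply/eqP; rewrite eqn_leq rA (leq_trans le_i) // -ltnS.
rewrite rAn in no_support le_i *; exists 1%N; rewrite addn1; split=> //.
  by move=> i' j'; rewrite leqNgt ltn_ord.
move=> v v0 vB; apply/rowP => l; rewrite mxE.
have off l' : l' != i -> v 0 l' = 0.
  move=> ne_l'; apply: v0; rewrite ltn_ord andbT -ltnNge ltn_neqAle.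
  rewrite -ltnS ltn_ord andbT; apply: contra ne_l' => /eqP l'n.
  apply/eqP/val_inj; rewrite /= l'n; apply/eqP.
  by rewrite eqn_leq le_i -ltnS ltn_ord.
have [->|/off //] := eqVneq l i.
have := vB j (ltn_ord j); rewrite mxE (bigD1 i) //= big1 => [|l' /off->].
  by move/eqP; rewrite addr0 mulf_eq0 (negPf Bij) orbF => /eqP.
by rewrite mul0r.
Qed.

(** * The nilpotent obstruction to surjectivity *)

(** On rows [row_mx 0 v], the matrix [Y ^+ k] acts through [N]. Nilpotency of [N] makes some power
    of [Y] annihilate these rows, so [Y ^+ (r + s)] already does, and hence [Y ^+ (k * i)]. *)
Lemma nilpotent_quotient_kth_power (F : fieldType) (r s k i j : nat)
    (Y : 'M[F]_(r + s)) (N : 'M[F]_s) : dsubmx (Y ^+ k) = row_mx 0 N ->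
  N ^+ j = 0 -> (r + s <= k * i)%N -> N ^+ i = 0.
Proof.
move=> DN Nj0 le_n.
have vYX (v : 'rV_s) l : row_mx 0 v *m Y ^+ (k * l) = row_mx 0 (v *m N ^+ l).
  elim: l v => [|l IHl] v; first by rewrite muln0 !expr0 !mulmx1.
  rewrite mulnS exprD -mulmxE mulmxA -[Y ^+ k]vsubmxK DN mul_row_col mul0mx.
  by rewrite add0r mul_mx_row mulmx0 IHl exprS -mulmxE mulmxA.
apply/row_matrixP => l; rewrite rowE row0.
have : row_mx (0 : 'rV_r) (delta_mx 0 l : 'rV_s) *m Y ^+ (k * j) = 0.
  by rewrite vYX Nj0 mulmx0 row_mx0.
move/mulmx_exp_dim_eq0 => vYn; apply/eqP.
have : row_mx (0 : 'rV_r) (delta_mx 0 l : 'rV_s) *m Y ^+ (k * i) = 0.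
  by rewrite -(subnKC le_n) exprD -mulmxE mulmxA vYn mul0mx.
by rewrite vYX => /eqP; rewrite row_mx_eq0 => /andP[].
Qed.

(** Adding [A *m Y ^+ k] leaves the last [s] rows unchanged, so the k-th power [X ^+ k] induces the
    same [N] as [B]. *)
Lemma not_omega_image_nilpotent (F : fieldType) (r s k i j : nat)
    (A B : 'M[F]_(r.+1 + s)) (N : 'M[F]_s) : zero_below r.+1 A ->
  dsubmx B = row_mx 0 N -> N ^+ j = 0 -> (r.+1 + s <= k * i)%N ->
  @omega_image F (r + s) k A B -> N ^+ i = 0.
Proof.
move=> A0 BN Nj le_n [X [Y BXY]].
apply: (@nilpotent_quotient_kth_power F r.+1 s k i j X N) _ Nj le_n.
have /zero_below_dsubmx AY0 := zero_below_mulmx (Y ^+ k) A0.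
by rewrite -BN -BXY /omega [RHS]linearD /= [X in _ + X]AY0 addr0.
Qed.

Lemma not_omega_surjective_nilpotent (F : fieldType) (r s k i j : nat)
    (A : 'M[F]_(r.+1 + s)) (N : 'M[F]_s) : \rank A = r.+1 ->
  N ^+ j = 0 -> N ^+ i != 0 -> (r.+1 + s <= k * i)%N ->
  ~ @omega_surjective F (r + s) k A.
Proof.
move=> rA Nj Ni le_n; have [P uP A0] := zero_below_conj A.
rewrite rA in A0.
move=> /(@omega_surjective_conj F (r + s) k A P uP).
move=> /(_ (block_mx 0 0 0 N : 'M_(r.+1 + s))).
have BN : dsubmx (block_mx 0 0 0 N : 'M_(r.+1 + s)) = row_mx 0 N.
  by rewrite /block_mx col_mxKd.
by move/(not_omega_image_nilpotent A0 BN Nj le_n)/eqP; apply/negP.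
Qed.

(** * The case of nullity two *)

Lemma dsubmx_conj_block (F : fieldType) (r s : nat) (g : 'M[F]_s)
    (M : 'M_(r + s)) : g \in unitmx ->
  dsubmx (invmx (block_mx 1%:M 0 0 g) *m M *m block_mx 1%:M 0 0 g) =
  invmx g *m dsubmx M *m block_mx 1%:M 0 0 g.
Proof.
move=> ug; rewrite invmx_block_diag ?block_diag_mx_unit ?unitmx1 //.
by rewrite -[M in LHS]vsubmxK mul_block_col !mul0mx add0r mul_col_mx col_mxKd.
Qed.

(* The alternative is the bad shape: modulo the column space of [A], [B] is
   a nonzero square-zero 2 x 2 block. *)
Lemma corank2_dichotomy (F : closedFieldType) (charF0 : [pchar F] =i pred0)
    (r k : nat) (A B : 'M[F]_(r.+1 + 2)) : (0 < k)%N ->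
  zero_below r.+1 A -> \rank A = r.+1 ->
  @omega_image F (r + 2) k A B \/
  exists (g : 'M_2) (w : F), [/\ g \in unitmx, w != 0 &
    dsubmx (invmx (block_mx 1%:M 0 0 g) *m B *m block_mx 1%:M 0 0 g) =
    row_mx 0 (w *: delta_mx 0 1)].
Proof.
move=> k_gt0 A0 rA.
have good m (A' B' : 'M[F]_(r.+1 + 2)) :
    zero_below r.+1 A' -> \rank A' = r.+1 -> (r.+1 + m <= r.+1 + 2)%N ->
    zero_below (r.+1 + m) B' ->
    (forall v : 'rV_(r.+1 + 2),
      (forall j : 'I_(r.+1 + 2), ~~ (r.+1 <= j < r.+1 + m)%N -> v 0 j = 0) ->
      (forall j : 'I_(r.+1 + 2), (j < r.+1 + m)%N -> (v *m B') 0 j = 0) ->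
      v = 0) ->
    @omega_image F (r + 2) k A' B'.
  move=> A'0 rA' le_m B'0 freeB'.
  have [X [T [-> T0 rT]]] := kth_power_plus_rank charF0 k_gt0 le_m B'0 freeB'.
  exact: (@omega_image_sub F charF0 (r + 2) k r.+1 A' X T).
pose C := dsubmx B; have : (\rank C <= 2)%N := rank_leq_row C.
rewrite leq_eqVlt => /orP[/eqP rC | ].
  left; apply: (good 2) => // [i j | v v0 vB]; first by rewrite leqNgt ltn_ord.
  have Dv : v = row_mx 0 (rsubmx v).
    rewrite -[LHS]hsubmxK; congr row_mx; apply/rowP => j; rewrite !mxE v0 //.
    by rewrite /= leqNgt ltn_ord.
  have vB0 : v *m B = 0 by apply/rowP => j; rewrite vB // mxE.
  suff -> : v = row_mx 0 0 by rewrite row_mx0.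
  rewrite Dv; congr row_mx.
  apply: (@row_free_inj _ _ _ _ C); first by rewrite /row_free rC.
  rewrite mul0mx -vB0 Dv row_mxKr -[B in RHS]vsubmxK mul_row_col.
  by rewrite mul0mx add0r.
rewrite ltnS leq_eqVlt => /orP[/eqP rC | ]; last first.
  rewrite ltnS leqn0 mxrank_eq0 => /eqP C0.
  left; apply: (good 0%N) => [||||v v0 _] //; first by rewrite leq_add2l.
    by rewrite addn0; apply/zero_below_dsubmx.
  apply/rowP => j; rewrite v0 ?mxE // addn0.
  by case: leqP => //=; rewrite ltnNge => ->.
(* For [C] of rank one, this change of basis clears its second row. The remaining row allows [m = 1]
   as soon as it has a nonzero entry before the last column; otherwise the bad shape appears. *)
pose g := col_ebase C; pose P := block_mx 1%:M 0 0 g : 'M[F]_(r.+1 + 2).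
have ug : g \in unitmx by apply: col_ebase_unit.
have uP : P \in unitmx by rewrite block_diag_mx_unit unitmx1.
pose B' := invmx P *m B *m P.
have dB' : dsubmx B' = pid_mx 1 *m (row_ebase C *m P).
  rewrite dsubmx_conj_block // -/C mulmxA; congr (_ *m P).
  apply/(canLR (mulKmx ug)).
  by rewrite -{1}[C]mulmx_ebase rC mulmxA.
have dB'1 j : dsubmx B' 1 j = 0.
  by rewrite dB' mxE big1 // => l _; rewrite mxE andbF mul0r.
have dB'nz : dsubmx B' != 0.
  rewrite -mxrank_eq0 dsubmx_conj_block // mxrankMfree ?row_free_unit //.
  by rewrite eqmxMfull ?row_full_unit ?unitmx_inv // rC.
have [/existsP[j /andP[lt_j B'j]] | no_j] := boolP
  [exists j : 'I_(r.+1 + 2), (j < r.+1 + 1)%N && (dsubmx B' 0 j != 0)].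
  left; apply/(@omega_image_conj F (r + 2) k A B P uP).
  apply: (good 1%N); rewrite ?mxrank_conj //.
  - apply/zero_below_dsubmx; rewrite dsubmx_conj_block //.
    by rewrite (iffLR (zero_below_dsubmx A)) // mulmx0 mul0mx.
  - rewrite leq_add2l //.
  - move=> i l; case: (split_ordP i) => i' -> /=.
      by rewrite leqNgt ltn_addr.
    rewrite leq_add2l => i'_gt0; have -> : i' = 1.
      by apply/val_inj/eqP; rewrite eqn_leq i'_gt0 -ltnS ltn_ord.
    by have := dB'1 l; rewrite mxE.
  move=> v v0 vB; have off l : l != rshift r.+1 0 -> v 0 l = 0.
    move=> ne_l; apply: v0; apply: contra ne_l; rewrite addn1 ltnS -eqn_leq.
    by move=> /eqP r_l; apply/eqP/val_inj; rewrite /= addn0.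
  apply/rowP => l; rewrite mxE; have [->|/off //] := eqVneq l (rshift r.+1 0).
  have := vB j lt_j.
  rewrite mxE (bigD1 (rshift r.+1 0)) //= big1 => [|i /off->].
    move/eqP; rewrite addr0 mulf_eq0 => /orP[/eqP // | ].
    by move: B'j; rewrite mxE => /negPf->.
  by rewrite mul0r.
right; exists g, (dsubmx B' 0 (rshift r.+1 1)).
have DB' : dsubmx B' = row_mx 0 (dsubmx B' 0 (rshift r.+1 1) *: delta_mx 0 1).
  have dB'0 (j : 'I_(r.+1 + 2)) : (j < r.+1 + 1)%N -> dsubmx B' 0 j = 0.
    move=> lt_j; apply/eqP; apply: contraNT no_j => B'j.
    by apply/existsP; exists j; rewrite lt_j.
  have ord2 (i : 'I_2) : i = 0 \/ i = 1.
    by case: i => [[|[|//]]] lt_i; [left | right]; apply/val_inj.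
  apply/matrixP => i j; case: (ord2 i) => ->; last first.
    rewrite dB'1; case: (split_ordP j) => l ->.
      by rewrite row_mxEl mxE.
    by rewrite row_mxEr !mxE mulr0.
  case: (split_ordP j) => l ->.
    by rewrite row_mxEl [RHS]mxE dB'0 //= ltn_addr.
  rewrite row_mxEr; case: (ord2 l) => ->; last first.
    by rewrite [RHS]mxE [X in _ * X]mxE mulr1.
  by rewrite dB'0 /= ?ltn_add2l // !mxE mulr0.
split=> //; apply: contraNneq dB'nz => w0.
by rewrite DB' w0 scale0r row_mx0.
Qed.

(** The matrix sends [e] to [p] and [p] to zero, so only [p *m w] survives squaring. *)
Lemma expmx2_col_row (F : fieldType) (n : nat) (p e : 'cV[F]_n) (b w : 'rV_n) :
  b *m e = 1%:M -> b *m p = 0 -> w *m e = 0 -> w *m p = 0 ->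
  (p *m b + e *m w) ^+ 2 = p *m w.
Proof.
move=> be bp we wp; rewrite expr2 -mulmxE mulmxDl !mulmxDr.
rewrite !mulmxA -(mulmxA p b p) bp -(mulmxA p b e) be -(mulmxA e w p) wp.
by rewrite -(mulmxA e w e) we !mulmx0 !mul0mx mulmx1 !addr0 add0r.
Qed.

(** The matrix moves [e] to [e'], then to [p], then to zero; only the term starting from [e]
    survives in the cube. *)
Lemma expmx3_col_row (F : fieldType) (n : nat) (p e e' : 'cV[F]_n)
    (a b w : 'rV_n) :
  a *m e' = 1%:M -> a *m e = 0 -> a *m p = 0 ->
  b *m e = 1%:M -> b *m e' = 0 -> b *m p = 0 ->
  w *m e = 0 -> w *m e' = 0 -> w *m p = 0 ->
  (p *m a + e' *m b + e *m w) ^+ 3 = p *m w.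
Proof.
move=> ae' ae ap be be' bp we we' wp; set Y := _ + _.
have Yp : Y *m p = 0 by rewrite !mulmxDl -!mulmxA ap bp wp !mulmx0 !addr0.
have Ye' : Y *m e' = p.
  by rewrite !mulmxDl -!mulmxA ae' be' we' !mulmx0 !addr0 mulmx1.
have Ye : Y *m e = e'.
  by rewrite !mulmxDl -!mulmxA ae be we !mulmx0 add0r addr0 mulmx1.
rewrite exprS expr2 -!mulmxE {3}/Y !mulmxDr !mulmxA -[Y *m Y *m p]mulmxA Yp.
rewrite -[Y *m Y *m e']mulmxA Ye' -[Y *m Y *m e]mulmxA Ye Yp Ye'.
by rewrite mulmx0 !mul0mx !add0r.
Qed.

(** The i-th coordinate form is corrected by a multiple of [f] so as to vanish on [col_mx q u],
    while keeping the value 1 on the i-th basis vector. *)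
Lemma square_col_row (F : fieldType) (r s : nat) (i : 'I_r) (q : 'cV[F]_r)
    (u : 'cV_s) (f w : 'rV_s) : f *m u = 1%:M -> w *m u = 0 ->
  exists Y : 'M_(r + s), Y ^+ 2 = col_mx q u *m row_mx 0 w.
Proof.
move=> fu wu; pose b := row_mx (delta_mx 0 i) (- (q i 0) *: f).
exists (col_mx q u *m b + col_mx (delta_mx i 0) 0 *m row_mx 0 w).
apply: expmx2_col_row; rewrite mul_row_col ?mul0mx ?mulmx0 ?wu ?addr0 //.
  by rewrite mul_delta_mx; apply/matrixP => x y; rewrite !ord1 !mxE.
rewrite -rowE -scalemxAl fu; apply/matrixP => x y.
by rewrite !ord1 !mxE mulr1 addrN.
Qed.

(** One more intermediate vector is required than for a square, whence the two distinct indices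
    among the first [r]. *)
Lemma cube_col_row (F : fieldType) (r s : nat) (i i' : 'I_r) (q : 'cV[F]_r)
    (u : 'cV_s) (f w : 'rV_s) : i != i' -> f *m u = 1%:M -> w *m u = 0 ->
  exists Y : 'M_(r + s), Y ^+ 3 = col_mx q u *m row_mx 0 w.
Proof.
move=> ne_i fu wu; pose b l := row_mx (delta_mx 0 l) (- (q l 0) *: f).
pose e l := col_mx (delta_mx l 0) 0 : 'cV[F]_(r + s).
have be l : b l *m e l = 1%:M.
  rewrite mul_row_col mulmx0 addr0 mul_delta_mx.
  by apply/matrixP => x y; rewrite !ord1 !mxE.
have be0 l l' : l != l' -> b l *m e l' = 0.
  by move=> ne_l; rewrite mul_row_col mulmx0 addr0 mul_delta_mx_0.
have bp l : b l *m col_mx q u = 0.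
  rewrite mul_row_col -rowE -scalemxAl fu; apply/matrixP => x y.
  by rewrite !ord1 !mxE mulr1 addrN.
have we l : row_mx 0 w *m e l = 0 by rewrite mul_row_col mul0mx mulmx0 addr0.
exists (col_mx q u *m b i + e i *m b i' + e i' *m row_mx 0 w).
apply: expmx3_col_row; rewrite ?be ?be0 // 1?eq_sym //.
by rewrite mul_row_col mul0mx wu addr0.
Qed.

(** The matrix is [L + t *m f] with [L] killing [e]. If [L] is nonzero, its rank is at least [r - 1]
    because [r <= 2], so one well-chosen column [t] completes its column space. *)
Lemma adjust_column_row_free (F : fieldType) (r n : nat) (U : 'M[F]_(r, n))
    (e : 'cV_n) (f : 'rV_n) : (r <= 2)%N -> f *m e = 1%:M ->
  exists t, U - (U *m e - t) *m f = 0 \/ row_free (U - (U *m e - t) *m f).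
Proof.
move=> le_r fe; pose L := U - U *m e *m f.
have DU t : U - (U *m e - t) *m f = L + t *m f.
  by rewrite mulmxBl opprB addrA addrAC.
have [L0 | L_nz] := eqVneq L 0.
  by exists 0; left; rewrite DU L0 mul0mx addr0.
pose K := (L^T)^C%MS.
have rK : (\rank K <= 1)%N.
  rewrite mxrank_compl mxrank_tr leq_subLR (leq_trans le_r) // addn1 ltnS.
  by rewrite lt0n mxrank_eq0.
(* The complement of the column space of [L] is at most a line, so one row spans it; that row is
   zero when [L] already has full rank. *)
have eK : (nz_row K == K)%MS.
  rewrite -(mxrank_leqif_eq (nz_row_sub K)) rank_rV nz_row_eq0 -mxrank_eq0.
  by case: (\rank K) rK => [|[]].
exists (nz_row K)^T; right; rewrite DU; set t := _^T; set T := L + _.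
have Le : L *m e = 0 by rewrite mulmxBl -[_ *m f *m e]mulmxA fe mulmx1 addrN.
have Te : T *m e = t by rewrite mulmxDl Le add0r -mulmxA fe mulmx1.
have DLt : row_mx L t = T *m row_mx (1%:M - e *m f) e.
  by rewrite mul_mx_row mulmxBr mulmxA Te mulmx1 addrK.
rewrite -row_leq_rank.
apply: leq_trans (mxrankM_maxl T (row_mx (1%:M - e *m f) e)); rewrite -DLt.
rewrite -mxrank_tr tr_row_mx trmxK col_leq_rank -(eq_row_full (addsmxE _ _)).
rewrite (eq_row_full (adds_eqmx (eqmx_refl _) (eqmxP eK))).
exact: addsmx_compl_full.
Qed.

(** Only the bad shape is left by the dichotomy. There the assumed k-th power reproduces the lower
    rows of [B], and the freedom in [q] adjusts the last column above them. *)
Lemma omega_surjective_corank2 (F : closedFieldType)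
    (charF0 : [pchar F] =i pred0) (r k : nat) (A : 'M[F]_(r.+1 + 2)) :
  (0 < k)%N -> (r.+1 <= 2)%N -> \rank A = r.+1 ->
  (forall (q : 'cV[F]_r.+1) (w : F), exists Y : 'M_(r.+1 + 2),
     Y ^+ k = col_mx q (delta_mx 0 0) *m row_mx 0 (w *: delta_mx 0 1)) ->
  @omega_surjective F (r + 2) k A.
Proof.
move=> k_gt0 le_r rA roots; have [P uP A0] := zero_below_conj A.
apply/(@omega_surjective_conj F (r + 2) k A P uP) => B.
rewrite rA in A0; have := mxrank_conj A uP; rewrite rA.
move: (invmx P *m A *m P) A0 => {P uP rA}A A0 rA.
have [//|[g [w [ug w_nz]]]] := corank2_dichotomy charF0 B k_gt0 A0 rA.
set P := block_mx _ _ _ _ => DB.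
have uP : P \in unitmx by rewrite block_diag_mx_unit unitmx1.
apply/(@omega_image_conj F (r + 2) k A B P uP).
have {}A0 : zero_below r.+1 (invmx P *m A *m P).
  apply/zero_below_dsubmx; rewrite dsubmx_conj_block //.
  by rewrite (iffLR (zero_below_dsubmx A) A0) mulmx0 mul0mx.
have := mxrank_conj A uP; rewrite rA.
move: (invmx P *m A *m P) (invmx P *m B *m P) A0 DB.
move=> {P g ug uP rA}A {}B A0 DB rA.
pose f := row_mx 0 (delta_mx 0 1) : 'rV[F]_(r.+1 + 2).
pose e := col_mx 0 (delta_mx 1 0) : 'cV[F]_(r.+1 + 2).
have fe : f *m e = 1%:M.
  rewrite mul_row_col mul0mx add0r mul_delta_mx.
  by apply/matrixP => x y; rewrite !ord1 !mxE.
have [t dT] := adjust_column_row_free (usubmx B) le_r fe.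
move: dT; set T := usubmx B - _ => dT.
(* This [q] makes the upper part of [Y ^+ k] equal to [(usubmx B *m e - t) *m f], leaving exactly
   [T] as the difference. *)
have [Y DY] := roots (w^-1 *: (usubmx B *m e - t)) w.
have {DY} -> : B = Y ^+ k + col_mx T 0.
  rewrite DY mul_col_mx add_col_mx addr0 -[LHS]vsubmxK; congr col_mx.
    rewrite -scalemxAl -[0 : 'rV__](scaler0 _ w) -scale_row_mx -scalemxAr.
    by rewrite scalerA mulVf // scale1r addrC subrK.
  by rewrite DB mul_mx_row mulmx0 -scalemxAr mul_delta_mx.
have T0 : zero_below r.+1 (col_mx T 0 : 'M_(r.+1 + 2)).
  by apply/zero_below_dsubmx; rewrite col_mxKd.
(* If [T] is zero, [B] is itself a k-th power; otherwise [T] has the rank of [A]. *)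
case: dT => [-> | /eqP rT].
  exists Y, 0; rewrite /omega expr0n eqn0Ngt k_gt0 mulr0 col_mx0.
  by rewrite !addr0.
apply: (@omega_image_sub F charF0 (r + 2) k r.+1 A Y _ k_gt0) => //.
exact: etrans (rank_col_mx0 2 T) rT.
Qed.

(** * Explicit nilpotents, and the image in size three *)

Lemma delta01_sqr0 (F : fieldType) : (delta_mx 0 1 : 'M[F]_2) ^+ 2 = 0.
Proof. by rewrite expr2 -mulmxE mul_delta_mx_0. Qed.

Lemma delta01_neq0 (F : fieldType) : (delta_mx 0 1 : 'M[F]_2) != 0.
Proof.
apply/eqP => /matrixP/(_ 0 1)/eqP.
by rewrite !mxE !eqxx oner_eq0.
Qed.

Lemma jordan3_nilpotent (F : fieldType) :
  let J := delta_mx 0 1 + delta_mx 1 2%R : 'M[F]_3 in J ^+ 2 != 0 /\ J ^+ 3 = 0.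
Proof.
move=> J; have J2 : J ^+ 2 = delta_mx 0 2%R.
  rewrite expr2 -mulmxE mulmxDl !mulmxDr !mul_delta_mx_cond /=.
  by rewrite !mulr0n mulr1n add0r !addr0.
split; last first.
  by rewrite exprS J2 -mulmxE mulmxDl !mul_delta_mx_cond !mulr0n addr0.
rewrite J2; apply/eqP => /matrixP/(_ 0 2%R)/eqP.
by rewrite !mxE !eqxx oner_eq0.
Qed.

Lemma omega_image_Z (F : closedFieldType) (charF0 : [pchar F] =i pred0)
    (k : nat) (A B : 'M[F]_3) : (3 <= k)%N -> A != 0 -> first_row_only A ->
  omega_image k A B <-> Z B.
Proof.
move=> k_ge3 A_nz A0.
have {}A0 : @zero_below F 1 (1 + 2) (1 + 2) A.
  by move=> i j i_gt0; apply: A0; rewrite -val_eqE -lt0n.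
have rA : \rank A = 1%N.
  apply/eqP; rewrite eqn_leq lt0n mxrank_eq0 A_nz andbT.
  have DA : col_mx (@usubmx _ 1 2 _ A) 0 = A.
    by rewrite -[RHS](@vsubmxK _ 1 2) (iffLR (@zero_below_dsubmx _ 1 2 _ A) A0).
  have <- := etrans (esym (rank_col_mx0 2 _)) (congr1 mxrank DA).
  exact: rank_leq_row.
split=> [imB [mu [u [M [M_nz M2 DB]]]] | ZB].
  have BM : @dsubmx _ 1 2 (1 + 2) B = row_mx 0 M.
    by rewrite DB /block_mx col_mxKd.
  have := @not_omega_image_nilpotent F 0 2 k 1 2 A B M A0 BM M2.
  by rewrite muln1 expr1 => /(_ k_ge3 imB)/eqP; apply/negP.
have [//|[g [w [ug w_nz]]]] :=
  @corank2_dichotomy F charF0 0 k A B (ltnW (ltnW k_ge3)) A0 rA.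
set P := block_mx _ _ _ _ => DB; case: ZB.
have uP : P \in unitmx by rewrite block_diag_mx_unit unitmx1.
pose N := w *: delta_mx 0 1 : 'M[F]_2.
(* The witnesses are read off [B] in its original basis, so the normalized nilpotent [N] has to be
   conjugated back by [g]. *)
exists (@ulsubmx _ 1 2 1 2 B 0 0), (@ursubmx _ 1 2 1 2 B), (g *m N *m invmx g).
split.
- apply: contra_neq (delta01_neq0 F) => gN0.
  apply: (scalerI w_nz); rewrite -/N scaler0.
  have <- : invmx g *m (g *m N *m invmx g) *m g = N.
    by rewrite !mulmxA mulVmx // mul1mx mulmxKV.
  by rewrite gN0 mulmx0 mul0mx.
- rewrite expr2 -mulmxE !mulmxA mulmxKV // -[g *m N *m N]mulmxA.
  have -> : N *m N = 0.
    by rewrite -scalemxAl -scalemxAr mul_delta_mx_0 // !scaler0.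
  by rewrite mulmx0 mul0mx.
rewrite -mx11_scalar -[LHS](@submxK _ 1 2 1 2).
have {}DB : @dsubmx _ 1 2 (1 + 2) B = row_mx 0 (g *m N *m invmx g).
  move: DB; rewrite dsubmx_conj_block // => /(canRL (mulmxK uP)).
  move/(canRL (mulKVmx ug)) => ->.
  rewrite invmx_block_diag // invmx1 mul_row_block !mulmx0 !mul0mx addr0 add0r.
  by rewrite mul_mx_row mulmx0 mulmxA.
by rewrite /dlsubmx /drsubmx DB row_mxKl row_mxKr.
Qed.

(** * Case analysis on the size and the nullity *)

Theorem corollary1p4 (F : closedFieldType) (charF0 : [pchar F] =i pred0)
    (k : nat) (k_ge2 : (2 <= k)%N) :
  (forall A : 'M[F]_3, A != 0 ->
     [/\ nullity A = 0%N \/ nullity A = 1%N -> omega_surjective k A,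
         nullity A = 2%N ->
           (k = 2%N -> omega_surjective k A) /\
           ((3 <= k)%N -> ~ omega_surjective k A) &
         ~ omega_surjective k A ->
           (exists2 P : 'M[F]_3, P \in unitmx &
              first_row_only (invmx P *m A *m P)) /\
           (forall P : 'M[F]_3, P \in unitmx ->
              first_row_only (invmx P *m A *m P) ->
              forall B : 'M[F]_3,
                omega_image k A B <-> Z (invmx P *m B *m P))])
  /\
  (forall A : 'M[F]_4, A != 0 ->
     [/\ nullity A = 0%N \/ nullity A = 1%N -> omega_surjective k A,
         nullity A = 2%N ->
           (k = 2%N \/ k = 3%N -> omega_surjective k A) /\
           ((4 <= k)%N -> ~ omega_surjective k A) &
         nullity A = 3%N -> ~ omega_surjective k A]).
Proof.
have k_gt0 : (0 < k)%N by apply: ltnW.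
have pair : (delta_mx 0 0 : 'rV[F]_2) *m (delta_mx 0 0 : 'cV[F]_2) = 1%:M.
  by rewrite mul_delta_mx; apply/matrixP => x y; rewrite !ord1 !mxE.
have pair0 (w : F) :
    (w *: delta_mx 0 1 : 'rV[F]_2) *m (delta_mx 0 0 : 'cV[F]_2) = 0.
  by rewrite -scalemxAl mul_delta_mx_0 // scaler0.
have rank_of n (A : 'M[F]_n) m : nullity A = m -> \rank A = (n - m)%N.
  by rewrite /nullity mxrank_coker => <-; rewrite subKn // rank_leq_row.
split=> A A_nz.
  have le2 : nullity A = 0%N \/ nullity A = 1%N -> omega_surjective k A.
    by case=> /rank_of rA; apply: omega_surjective_corank_le1; rewrite ?rA.
  have sq : nullity A = 2%N -> k = 2%N -> omega_surjective k A.
    move=> /rank_of rA k2; apply: (@omega_surjective_corank2 F charF0 0) => //.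
    move=> q w; rewrite k2.
    exact: (@square_col_row _ _ _ 0 q _ _ _ pair (pair0 w)).
  split=> // [nulA | nsurj].
    split=> [|k_ge3]; first exact: sq.
    apply: (@not_omega_surjective_nilpotent F 0 2 k 1 2 A _ (rank_of _ _ _ nulA)
      (delta01_sqr0 F)); last by rewrite muln1.
    by rewrite expr1 delta01_neq0.
  (* Nullity 3 is excluded by [A != 0], and nullities 0 and 1 by the failure of surjectivity. *)
  have nul2 : nullity A = 2%N.
    have : (nullity A <= 2)%N.
      rewrite /nullity mxrank_coker leq_subLR addnC -ltn_subLR ?subnn //.
      by rewrite lt0n mxrank_eq0.
    case: (nullity A) le2 => [|[|[|//]]] le2 _ //;
      by case: nsurj; apply: le2; by [left | right].
  have k_ge3 : (3 <= k)%N.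
    by rewrite ltn_neqAle k_ge2 andbT; apply/eqP => /esym/(sq nul2).
  split=> [|P uP A0 B].
    have [P uP] := zero_below_conj A; rewrite (rank_of _ _ _ nul2) => A0.
    by exists P => // i j i_nz; apply: A0; rewrite lt0n.
  apply: (iff_trans (omega_image_conj k A B uP)); apply: omega_image_Z => //.
  by rewrite -mxrank_eq0 mxrank_conj // mxrank_eq0.
split=> [|nulA|nulA].
- by case=> /rank_of rA; apply: omega_surjective_corank_le1; rewrite ?rA.
- have rA := rank_of _ _ _ nulA; split=> [k23|k_ge4].
    apply: (@omega_surjective_corank2 F charF0 1) => // q w.
    case: k23 => ->.
      exact: (@square_col_row _ _ _ 0 q _ _ _ pair (pair0 w)).
    exact: (@cube_col_row _ _ _ 0 1 q _ _ _ _ pair (pair0 w)).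
  apply: (@not_omega_surjective_nilpotent F 1 2 k 1 2 A _ rA (delta01_sqr0 F)).
    by rewrite expr1 delta01_neq0.
  by rewrite muln1.
(* In the three-dimensional quotient, [J ^+ 2] is nonzero; as [4 <= k * 2] for every [k >= 2], the
   obstruction applies with [i = 2]. *)
have [J2 J3] := jordan3_nilpotent F.
apply: (@not_omega_surjective_nilpotent F 0 3 k 2 3 A _ _ J3 J2).
  exact: rank_of nulA.
by rewrite (leq_mul k_ge2 (leqnn 2)).
Qed.
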